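(* Let $X$ and $Y$ be independent, identically distributed, non-negative, absolutely continuous random variables. Then $X$ and $\max\left\{\frac{X}{Y},\frac{Y}{X}\right\}$ have the same distribution if and only if the distribution of $X$ belongs to the family $\mathcal{P}$.
   Context: $\mathcal{P}$ denotes the family of Pareto distributions with distribution functions $F(x)=1-x^{-\alpha}$, $x\ge 1$, where $\alpha>0$ ranges over all positive reals. *)

(* Defs.v *)
From HB Require Import structures.
From mathcomp Require Import all_boot all_order all_algebra.
From mathcomp Require Import all_classical all_reals all_analysis.
Set Implicit Arguments. Unset Strict Implicit. Unset Printing Implicit Defensive.
Import Order.TTheory GRing.Theory Num.Theory.
Local Open Scope classical_set_scope.
Local Open Scope ring_scope.

Definition indep2 (d : measure_display) (T : measurableType d) (R : realType)
  (P : probability T R) (X Y : T -> R) : Prop :=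
  forall A B : set R, measurable A -> measurable B ->
    P (X @^-1` A `&` Y @^-1` B) = (P (X @^-1` A) * P (Y @^-1` B))%E.

Definition same_law (d : measure_display) (T : measurableType d) (R : realType)
  (P : probability T R) (X Y : T -> R) : Prop :=
  forall A : set R, measurable A -> P (X @^-1` A) = P (Y @^-1` A).

Definition abs_continuous (d : measure_display) (T : measurableType d)
  (R : realType) (P : probability T R) (X : T -> R) : Prop :=
  forall A : set R, measurable A -> (@lebesgue_measure R) A = 0%E ->
    P (X @^-1` A) = 0%E.

Definition nonneg_rv (d : measure_display) (T : measurableType d)
  (R : realType) (P : probability T R) (X : T -> R) : Prop :=
  P [set w | X w < 0] = 0%E.

Definition pareto_cdf (R : realType) (alpha x : R) : R :=
  if x < 1 then 0 else 1 - x `^ (- alpha).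

Definition pareto_law (d : measure_display) (T : measurableType d)
  (R : realType) (P : probability T R) (X : T -> R) : Prop :=
  exists alpha : R, 0 < alpha /\
    forall x : R, P (X @^-1` `]-oo, x]) = (pareto_cdf alpha x)%:E.

(* Main.v *)
(** Pass to logarithms: [U = ln X], [V = ln Y], and let [H] be the survival
function of [U].  The hypothesis that [X] and [max (X / Y, Y / X)] have the
same law says that [U >= 0] and that [|U - V|] is distributed as [U], that is
[H t = 2 E (H (t + U))] for [t >= 0]; one has to see that [U] is exponential.

Let [a] be a point such that [P (b < U <= a) > 0] for all [b < a], and let [M]
be the supremum over [t] of [H (t + a) / H t].  The same equation holds for
[t + a], so if the supremum is nearly attained at [t], it is nearly attained at
[t + v] for some [v] of the support close to [a].  Iterating, [H] decays from
[t] on no faster than [M ^ (s / a)] over arbitrarily long ranges of [s].  If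
[M > exp (- b a)] with [2 E (exp (- b U)) > 1], substituting this minorant
repeatedly into the equation makes [H t] exceed itself.  Hence
[H a <= exp (- b a)], and at the supremum [l] of all such [b] one gets
[H <= exp (- l v)] for almost all [v], with
[2 E (exp (- l U)) <= 1 = 2 E (H U)].  So [H U = exp (- l U)] almost surely, and
[H U] is uniform because the law of [U] has no atoms. *)
Require Import Defs.
From HB Require Import structures.
From mathcomp Require Import all_boot all_order all_algebra.
From mathcomp Require Import all_classical all_reals all_analysis.
From mathcomp Require Import measurable_realfun lra.
Import Order.TTheory GRing.Theory Num.Theory.
Import numFieldNormedType.Exports.
Local Open Scope classical_set_scope.
Local Open Scope ring_scope.

(** * Integrals and continuity from above for finite measures *)

Section finite_measure_facts.
Context {d : measure_display} {T : measurableType d} {R : realType}.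
Variable mu : {finite_measure set T -> \bar R}.

Lemma bounded_integrable (A : set T) (f : T -> R) (M : R) :
  measurable A -> measurable_fun setT f -> (forall x, A x -> `|f x| <= M) ->
  mu.-integrable A (EFin \o f).
Proof.
move=> mA mf fM; apply: measurable_bounded_integrable => //.
- by rewrite -ge0_fin_numE// fin_num_measure.
- exact: measurable_funTS.
- exists M; split; first exact: num_real.
  by move=> K MK x Ax /=; apply: le_trans (fM x Ax) _; exact: ltW.
Qed.

Lemma Rintegral_subset (A B : set T) (f : T -> R) :
  measurable A -> measurable B -> A `<=` B ->
  mu.-integrable B (EFin \o f) -> (forall x, B x -> 0 <= f x) ->
  \int[mu]_(x in A) f x <= \int[mu]_(x in B) f x.
Proof.
move=> mA mB AB fi f0; apply: fine_le.
- apply: (integrable_fin_num mA); exact: integrableS fi.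
- exact: integrable_fin_num.
- apply: ge0_subset_integral => //.
  by case/integrableP : fi.
Qed.

Lemma measure_fine_lt_bigcap (F : (set T)^nat) (e : R) :
  (forall n, measurable (F n)) -> nonincreasing_seq F ->
  mu (\bigcap_n F n) = 0%E -> 0 < e -> exists n, fine (mu (F n)) < e.
Proof.
move=> mF niF F0 e0.
have F0oo : (mu (F 0%N) < +oo)%E by rewrite -ge0_fin_numE// fin_num_measure.
have muF : mu (F n) @[n --> \oo] --> 0%E.
  by rewrite -F0; exact: nonincreasing_cvg_mu F0oo mF (bigcapT_measurable mF) niF.
move/fine_cvgP : muF => [_ /cvgr_lt/(_ e e0)/= [N _ NF]].
by exists N; exact: (NF N (leqnn N)).
Qed.
End finite_measure_facts.

(** * Real-valued probabilities and comparison of events up to null sets *)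

Section probability_facts.
Context {d : measure_display} {T : measurableType d} {R : realType}.
Variable mu : probability T R.
Implicit Types A B N : set T.

Lemma fine_measure_le A B : measurable A -> measurable B ->
  A `<=` B -> fine (mu A) <= fine (mu B).
Proof.
by move=> mA mB AB; rewrite fine_le ?fin_num_measure// le_measure ?inE.
Qed.

Lemma fine_measureU A B : measurable A -> measurable B ->
  A `&` B = set0 -> fine (mu (A `|` B)) = fine (mu A) + fine (mu B).
Proof.
by move=> mA mB AB; rewrite measureU// fineD ?fin_num_measure.
Qed.

Lemma fine_measureC A : measurable A -> fine (mu (~` A)) = 1 - fine (mu A).
Proof.
move=> mA; have mCA := measurableC mA.
have : fine (mu setT) = 1 by rewrite probability_setT.
rewrite -(setUv A) fine_measureU//; last exact: setICr.
by move=> <-; rewrite addrC addKr.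
Qed.

Lemma fine_measure_le_null A B N : measurable A -> measurable B ->
  measurable N -> mu N = 0%E -> A `<=` B `|` N -> fine (mu A) <= fine (mu B).
Proof.
move=> mA mB mN N0 AB; apply: (@le_trans _ _ (fine (mu (B `|` N)))).
  by apply: fine_measure_le => //; exact: measurableU.
by rewrite measureU0.
Qed.

Lemma measure_eq_off_null A B N : measurable A -> measurable B ->
  measurable N -> mu N = 0%E -> (forall w, ~ N w -> (A w <-> B w)) ->
  mu A = mu B.
Proof.
move=> mA mB mN N0 AB.
rewrite -[LHS]fineK ?fin_num_measure// -[RHS]fineK ?fin_num_measure//.
congr EFin; apply/le_anti/andP; split; apply: (@fine_measure_le_null _ _ N) => // w.
  by move=> Aw; have [Nw|/AB[/(_ Aw) Bw _]] := pselect (N w); [right|left].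
by move=> Bw; have [Nw|/AB[_ /(_ Bw) Aw]] := pselect (N w); [right|left].
Qed.

Lemma measure_sub_null A N : measurable A -> measurable N -> mu N = 0%E ->
  A `<=` N -> mu A = 0%E.
Proof. by move=> mA mN N0 AN; exact: subset_measure0 N0. Qed.

End probability_facts.

(** * The survival function of a law on the line *)

Section tail.
Context {R : realType}.
Variable mu : probability R R.

Definition tail (t : R) : R := fine (mu `]t, +oo[%classic).

Lemma tail_ge0 t : 0 <= tail t.
Proof. exact: fine_ge0. Qed.

Lemma tail_le1 t : tail t <= 1.
Proof. by rewrite -lee_fin fineK ?fin_num_measure// probability_le1. Qed.

Lemma tail_nonincreasing : nonincreasing_fun tail.
Proof.
move=> s t st; apply: fine_measure_le => // x /=.
by rewrite !in_itv/= !andbT; exact: le_lt_trans.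
Qed.

Lemma measurable_tail : measurable_fun setT tail.
Proof. by apply: nonincreasing_measurable => //; exact: tail_nonincreasing. Qed.

Lemma tail_diff s t : s <= t -> tail s - tail t = fine (mu `]s, t]%classic).
Proof.
move=> st; rewrite /tail (_ : `]s, +oo[%classic = `]s, t] `|` `]t, +oo[).
  by rewrite fine_measureU ?addrK// -subset0 => x /=; rewrite !in_itv/= andbT;
    case=> /andP[_ xt]; rewrite ltNge xt.
by rewrite -itv_bndbnd_setU// bnd_simp.
Qed.

Lemma tail_lt_eventually (e : R) : 0 < e -> exists2 N, 0 < N & tail N < e.
Proof.
(* The index is [n.+1] because the threshold has to be strictly positive. *)
move=> e0; have [| | |//|n ne] := @measure_fine_lt_bigcap _ _ _ mu
  (fun n => `]n.+1%:R, +oo[%classic) e.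
- by [].
- move=> m n mn; apply/subsetPset => x /=; rewrite !in_itv/= !andbT.
  by apply: le_lt_trans; rewrite ler_nat.
- rewrite (_ : \bigcap_n _ = set0) ?measure0// -subset0 => x /= xn.
  have := xn (Num.truncn x) I; rewrite /= in_itv/= andbT ltNge.
  by rewrite ltW// truncnS_gt.
- by exists n.+1%:R.
Qed.

Hypothesis atomless : forall x, mu [set x] = 0%E.

(** An increment of [tail] near [z] is at most the mass of []z - r, z + r]], and these intervals
    shrink to the null set [[set z]]. *)
Lemma tail_continuous : continuous tail.
Proof.
move=> z; apply/cvgrPdist_lt => e e0.
have [r r0 re] : exists2 r, 0 < r & fine (mu `]z - r, z + r]%classic) < e.
  suff [n ne] : exists n,
    fine (mu `]z - n.+1%:R^-1, z + n.+1%:R^-1]%classic) < e by exists n.+1%:R^-1.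
  apply: (@measure_fine_lt_bigcap _ _ _ mu
    (fun n => `]z - n.+1%:R^-1, z + n.+1%:R^-1]%classic)) => //.
  - move=> m n mn; apply/subsetPset => x /=; rewrite !in_itv/=.
    have : n.+1%:R^-1 <= m.+1%:R^-1 :> R by rewrite lef_pV2 ?posrE// ler_nat.
    by move: n.+1%:R^-1 m.+1%:R^-1 => p q pq /andP[zx xz]; apply/andP; split; lra.
  - rewrite (_ : \bigcap_n _ = [set z]); first exact: atomless.
    apply/seteqP; split.
      move=> x /= xn; apply: contrapT => /eqP xz.
      have e1 : 0 < `|x - z| by rewrite normr_gt0 subr_eq0.
      have := xn (Num.truncn `|x - z|^-1) I.
      have : (Num.truncn `|x - z|^-1).+1%:R^-1 < `|x - z|.
        by rewrite -[ltRHS]invrK ltf_pV2 ?posrE ?invr_gt0// truncnS_gt.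
      rewrite /= in_itv/=; move: _.+1%:R^-1 => d dxz /andP[zdx xzd].
      suff : `|x - z| <= d by rewrite leNgt dxz.
      by rewrite ler_norml; apply/andP; split; lra.
    move=> _ -> m _ /=; rewrite in_itv/=.
    have : 0 < m.+1%:R^-1 :> R by [].
    by move: _.+1%:R^-1 => p p0; apply/andP; split; lra.
near=> y.
have : `|z - y| < r by near: y; exact: cvgr_dist_lt.
rewrite ltr_norml => /andP[zy yz].
have key s t : z - r <= s -> s <= t -> t <= z + r ->
    `|tail s - tail t| < e.
  move=> zs st tz; apply: le_lt_trans re.
  rewrite tail_diff// ger0_norm ?fine_ge0//.
  apply: fine_measure_le => //; apply: subset_itv; rewrite bnd_simp; lra.
have [le_zy|/ltW le_yz] := leP z y; last rewrite distrC.
  by apply: key => //; lra.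
by apply: key => //; lra.
Unshelve. all: by end_near. Qed.

(** * Uniform distribution of [tail] under an atomless law *)

Hypothesis nonneg : mu `]-oo, 0[%classic = 0%E.

Lemma tail_at0 : tail 0 = 1.
Proof.
have : fine (mu setT) = 1 by rewrite probability_setT.
rewrite -(setUv `]0, +oo[%classic) setCitvr fine_measureU//; last first.
  by rewrite -setCitvr setICr.
rewrite (_ : `]-oo, 0]%classic = `]-oo, 0[ `|` [set (0:R)]); last first.
  by rewrite setUitv1.
rewrite fine_measureU//; last first.
  by rewrite -subset0 => x /= [] /[swap] ->; rewrite in_itv/= ltxx.
by rewrite atomless nonneg /= !addr0.
Qed.

Lemma tail_value (x : R) : 0 < x -> x <= 1 -> exists2 z, 0 <= z & tail z = x.
Proof.
move=> x0 x1; have [N N0 Nx] := tail_lt_eventually _ x0.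
have := @IVT _ tail 0 N x (ltW N0) _ _.
case.
- by apply: continuous_subspaceT; exact: tail_continuous.
- by rewrite tail_at0 ge_min le_max x1 (ltW Nx) orbT.
- by move=> c; rewrite in_itv/= => /andP[c0 _] cx; exists c.
Qed.

Lemma measurable_tail_lt x : measurable [set v | tail v < x].
Proof.
rewrite -[X in measurable X]setTI.
exact: (measurable_tail measurableT `]-oo, x[%classic).
Qed.

Lemma measurable_tail_le x : measurable [set v | tail v <= x].
Proof.
rewrite -[X in measurable X]setTI.
exact: (measurable_tail measurableT `]-oo, x]%classic).
Qed.

(** With [tail_le_measure], this is the uniformity of [tail v] under [mu]. By continuity [x] is some
    [tail z], and by monotonicity []z, +oo[] contains the points where [tail v < x] and is contained
    in those where [tail v <= x]. *)
Lemma tail_lt_measure x : 0 <= x -> fine (mu [set v | tail v < x]) <= x.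
Proof.
rewrite le_eqVlt => /predU1P[<-|x0].
  rewrite (_ : [set _ | _] = set0) ?measure0// -subset0 => v /=.
  by rewrite ltNge tail_ge0.
have [x1|/ltW x1] := leP x 1; last first.
  have mx := measurable_tail_lt x.
  by apply: le_trans x1; rewrite -lee_fin fineK ?fin_num_measure// probability_le1.
have [z _ zx] := tail_value _ x0 x1.
rewrite -[leRHS]zx; apply: fine_measure_le => //; first exact: measurable_tail_lt.
move=> v /=; rewrite in_itv/= andbT -zx => vz; rewrite ltNge; apply/negP.
by move/tail_nonincreasing; rewrite leNgt vz.
Qed.

Lemma tail_le_measure x : x <= 1 -> x <= fine (mu [set v | tail v <= x]).
Proof.
move=> x1; have [x0|x0] := ltP 0 x; last exact: (le_trans x0 (fine_ge0 _)).
have [z _ zx] := tail_value _ x0 x1.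
rewrite -[leLHS]zx; apply: fine_measure_le => //; first exact: measurable_tail_le.
by move=> v /=; rewrite in_itv/= andbT -zx => /ltW; exact: tail_nonincreasing.
Qed.

Lemma measurable_tail_eq x : measurable [set v | tail v = x].
Proof.
rewrite -[X in measurable X]setTI.
exact: (measurable_tail measurableT [set x]).
Qed.

(** The level set is disjoint from the set where [tail v <= tail c - e / 2], and both lie in the set
    where [tail v < tail c + e / 2]. By uniformity this leaves the level set a mass of at most
    [e]. *)
Lemma tail_level_null c : mu [set v | tail v = tail c] = 0%E.
Proof.
apply/eqP; rewrite eq_le measure_ge0 andbT; apply/lee_addgt0Pr => e e0.
rewrite add0e -[leLHS]fineK ?fin_num_measure//; last exact: measurable_tail_eq.
rewrite lee_fin.
have c0 := tail_ge0 c; have c1 := tail_le1 c.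
have Uub : fine (mu [set v | tail v < tail c + e / 2]) <= tail c + e / 2.
  by apply: tail_lt_measure; lra.
have Llb : tail c - e / 2 <= fine (mu [set v | tail v <= tail c - e / 2]).
  by apply: tail_le_measure; lra.
suff : fine (mu [set v | tail v = tail c]) +
    fine (mu [set v | tail v <= tail c - e / 2]) <=
    fine (mu [set v | tail v < tail c + e / 2]) by lra.
rewrite -fine_measureU//; [|exact: measurable_tail_eq|exact: measurable_tail_le|].
  apply: fine_measure_le.
  - by apply: measurableU; [exact: measurable_tail_eq|exact: measurable_tail_le].
  - exact: measurable_tail_lt.
  - by move=> v /= [->|]; lra.
by rewrite -subset0 => v /= [->]; lra.
Qed.

End tail.

(** * A Deny-type integral equation for the tail, and the exponential upper bound *)

Section deny.
Context {R : realType}.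
Variable mu : probability R R.
Local Notation tail := (tail mu).
Local Notation Rplus := (`[(0 : R), +oo[%classic).

Lemma integrable_tail_shift (A : set R) (t : R) : measurable A ->
  mu.-integrable A (EFin \o (fun v => tail (t + v))).
Proof.
move=> mA; apply: (@bounded_integrable _ _ _ _ _ _ 1) => //.
  apply: (measurableT_comp (measurable_tail mu)).
  exact: measurable_funD.
by move=> x _; rewrite ger0_norm ?tail_ge0// tail_le1.
Qed.

Lemma integrable_scale (A : set R) (k : R) (f : R -> R) : measurable A ->
  mu.-integrable A (EFin \o f) -> mu.-integrable A (EFin \o (fun v => k * f v)).
Proof. by move=> mA fi; exact: (integrableZl mA k fi). Qed.

Lemma measurable_expRN (b : R) : measurable_fun setT (fun v => expR (- (b * v))).
Proof.
apply: (measurableT_comp (@measurable_expR R)).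
by apply: measurableT_comp => //; exact: measurable_funM.
Qed.

Lemma integrable_expRN (A : set R) (b : R) : measurable A -> A `<=` Rplus ->
  0 <= b -> mu.-integrable A (EFin \o (fun v => expR (- (b * v)))).
Proof.
move=> mA AR b0; apply: (@bounded_integrable _ _ _ _ _ _ 1) => //.
  exact: measurable_expRN.
move=> x /AR /=; rewrite in_itv/= andbT => x0.
by rewrite ger0_norm ?expR_ge0// -expR0 ler_expR oppr_le0 mulr_ge0.
Qed.

(** The integrand is at most 1, so cutting at [N] loses at most [tail N]. The cut is needed because
    exponential minorants of [tail] will be available on bounded ranges only. *)
Lemma laplace_truncation (b : R) : 0 <= b ->
  1 < 2 * \int[mu]_(v in Rplus) expR (- (b * v)) ->
  exists2 N, 0 < N & 1 < 2 * \int[mu]_(v in `[0, N]%classic) expR (- (b * v)).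
Proof.
move=> b0 hb; set L := \int[mu]_(v in _) _ in hb.
have [|N N0 hN] := tail_lt_eventually mu (L - 2^-1); first by lra.
exists N => //.
suff : L <= \int[mu]_(v in `[0, N]%classic) expR (- (b * v)) + tail N by lra.
have DE : Rplus = `[0, N]%classic `|` `]N, +oo[%classic.
  by rewrite -itv_bndbnd_setU// bnd_simp ltW.
rewrite /L DE Rintegral_setU//; last 2 first.
- by rewrite -DE; exact: integrable_expRN.
- apply/disj_setPS => x /=; rewrite !in_itv/= andbT => -[/andP[_ xN]].
  by rewrite ltNge xN.
rewrite lerD2l -[leRHS]mul1r -(Rintegral_cst mu)//.
have NR : `]N, +oo[%classic `<=` Rplus.
  by move=> x /=; rewrite !in_itv/= !andbT => /ltW; apply: le_trans; exact: ltW.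
apply: le_Rintegral => //.
- exact: integrable_expRN.
- exact: finite_measure_integrable_cst.
- move=> x /NR /=; rewrite in_itv/= andbT => x0.
  by rewrite -expR0 ler_expR oppr_le0 mulr_ge0.
Qed.

Hypothesis tailE : forall t, 0 <= t ->
  tail t = 2 * \int[mu]_(v in Rplus) tail (t + v).

(** Substituting the minorant into the equation, with [v] restricted to [[0, N]], gains a factor
    [rho] and shortens the range of validity by [N]. A range of length [n * N] thus allows [n]
    substitutions. *)
Lemma exp_minorant_iter (b N : R) (n : nat) (t c : R) :
  0 <= b -> 0 < N -> 0 <= t -> 0 <= c ->
  (forall s, 0 <= s <= n%:R * N -> c * expR (- (b * s)) <= tail (t + s)) ->
  (2 * \int[mu]_(v in `[0, N]%classic) expR (- (b * v))) ^+ n * c <= tail t.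
Proof.
move=> b0 N0; set rho := 2 * _.
have rho0 : 0 <= rho by rewrite mulr_ge0// Rintegral_ge0// => x _; exact: expR_ge0.
have NR : `[0, N]%classic `<=` Rplus by apply: subset_itvl.
elim: n t c => [|n ih] t c t0 c0 h.
  have := h 0; rewrite mul0r lexx => /(_ isT).
  by rewrite mulr0 oppr0 expR0 mulr1 addr0 expr0 mul1r.
have step s : 0 <= s <= N -> rho ^+ n * c * expR (- (b * s)) <= tail (t + s).
  move=> /andP[s0 sN]; rewrite -mulrA; apply: ih.
  - exact: addr_ge0.
  - by rewrite mulr_ge0// expR_ge0.
  - move=> r /andP[r0 rn]; rewrite -mulrA -expRD -addrA.
    rewrite -opprD -mulrDr; apply: h; rewrite addr_ge0//=.
    by rewrite -natr1 mulrDl mul1r addrC lerD.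
rewrite exprS -mulrA mulrC mulrA tailE//.
rewrite (mulrC _ 2) -mulrA ler_pM2l//.
rewrite -RintegralZl//; last exact: integrable_expRN.
apply: (@le_trans _ _ (\int[mu]_(v in `[0, N]%classic) tail (t + v))).
  apply: le_Rintegral => //.
  - by apply: integrable_scale => //; exact: integrable_expRN.
  - exact: integrable_tail_shift.
apply: Rintegral_subset => //; first exact: integrable_tail_shift.
by move=> x _; exact: tail_ge0.
Qed.

(* [M * tail t - tail (t + a)] is twice the integral over [v] of the
   nonnegative quantities [M * tail (t + v) - tail (t + v + a)]. *)
Lemma near_max_step (a b m M e : R) : 0 < a -> 0 <= b -> 0 < m -> m < M ->
  0 < fine (mu `]b, a]%classic) -> 0 < e ->
  (forall t, 0 <= t -> tail (t + a) <= M * tail t) ->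
  exists2 e' : R, 0 < e' <= M - m & forall t, 0 <= t -> 0 < tail t ->
    (M - e') * tail t <= tail (t + a) ->
    exists v, [/\ b < v <= a, 0 < tail (t + v) &
      (M - e) * tail (t + v) <= tail (t + v + a)].
Proof.
move=> a0 b0 m0 mM; set p := fine _ => p0 e0 hM.
(* The bound [M - m] turns near-maximality at [t] into [m * tail t <= tail (t + a)]. The bound
   [e * p * m] is beaten by the lower estimate of the integral, thanks to the factor 2 in the
   equation. *)
pose e' := Num.min (M - m) (e * p * m).
have e'm : e' <= M - m by rewrite ge_min lexx.
have e'p : e' <= e * p * m by rewrite ge_min lexx orbT.
have e'0 : 0 < e' by rewrite lt_min subr_gt0 mM !mulr_gt0.
exists e'; first by rewrite e'0.
move=> t t0 tt0 het; apply: contrapT => hn.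
have mt : m * tail t <= tail (t + a).
  by apply: le_trans het; rewrite ler_wpM2r ?tail_ge0//; lra.
(* If no [v] is suitable, the integrand is at least [e * tail (t + v)] on []b, a]], a set of mass
   [p]. As [v <= a], this is at least [e * tail (t + a)], which is free of [v]. *)
have low v : b < v <= a ->
    e * tail (t + a) <= M * tail (t + v) - tail (t + a + v).
  move=> /andP[bv va].
  have tva : tail (t + a) <= tail (t + v).
    by apply: tail_nonincreasing; rewrite lerD2l.
  have tv0 : 0 < tail (t + v).
    by apply: lt_le_trans tva; apply: lt_le_trans mt; rewrite mulr_gt0.
  have : tail (t + v + a) < (M - e) * tail (t + v).
    by rewrite ltNge; apply/negP => ?; apply: hn; exists v; rewrite bv va.
  have : e * tail (t + a) <= e * tail (t + v) by rewrite ler_pM2l.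
  rewrite (addrAC t v a) mulrBl; lra.
have eqB : M * tail t - tail (t + a) =
    2 * \int[mu]_(v in Rplus) (M * tail (t + v) - tail (t + a + v)).
  rewrite RintegralB//; [|exact/integrable_scale/integrable_tail_shift
                         |exact: integrable_tail_shift].
  rewrite RintegralZl//; last exact: integrable_tail_shift.
  rewrite tailE// (tailE (t + a)) ?addr_ge0// ?(ltW a0)//; lra.
have integrable_gap (A : set R) : measurable A ->
    mu.-integrable A (EFin \o (fun v => M * tail (t + v) - tail (t + a + v))).
  move=> mA.
  have h1 := integrable_scale _ M _ mA (integrable_tail_shift _ t mA).
  exact: (integrableB mA h1 (integrable_tail_shift _ (t + a) mA)).
have : e * tail (t + a) * p <=
    \int[mu]_(v in Rplus) (M * tail (t + v) - tail (t + a + v)).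
  apply: (@le_trans _ _ (\int[mu]_(v in `]b, a]%classic)
    (M * tail (t + v) - tail (t + a + v)))).
    rewrite -Rintegral_cst//; apply: le_Rintegral => //.
    - exact: finite_measure_integrable_cst.
    - exact: integrable_gap.
  apply: Rintegral_subset => //.
  - by apply: subset_itv; rewrite bnd_simp// ltW.
  - exact: integrable_gap.
  - move=> v /=; rewrite in_itv/= andbT => v0.
    by rewrite subr_ge0 addrAC; apply: hM; exact: addr_ge0.
have : e * p * (m * tail t) <= e * p * tail (t + a).
  by rewrite ler_pM2l// mulr_gt0.
have : e' * tail t <= e * p * m * tail t by rewrite ler_pM2r.
have : 0 < e * p * (m * tail t) by rewrite !mulr_gt0.
move: het eqB; rewrite mulrBl.
have -> : e * p * m * tail t = e * p * (m * tail t) by rewrite !mulrA.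
have -> : e * tail (t + a) * p = e * p * tail (t + a) by rewrite mulrAC.
lra.
Qed.

(** Each jump from [t] to a near-maximal [t + v] has [b < v <= a], so [k] jumps cover a range of
    [k * b]. A jump costs at most a factor [m = expR (- (beta * b))], while the claimed minorant is
    allowed to drop by [expR (- (beta * v))], which is no less severe. The extra factor [m] in front
    pays for the last, incomplete jump. *)
Lemma near_max_chain (a b beta M : R) (k : nat) : 0 < b -> b < a -> 0 <= beta ->
  expR (- (beta * b)) < M -> 0 < fine (mu `]b, a]%classic) ->
  (forall t, 0 <= t -> tail (t + a) <= M * tail t) ->
  exists2 e : R, 0 < e & forall t, 0 <= t -> 0 < tail t ->
    (M - e) * tail t <= tail (t + a) ->
    forall s, 0 <= s <= k%:R * b ->
    expR (- (beta * b)) * tail t * expR (- (beta * s)) <= tail (t + s).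
Proof.
move=> b0 ba beta0; set m := expR (- (beta * b)) => mM p0 hM.
have m0 : 0 < m by exact: expR_gt0.
have m1 : m <= 1 by rewrite /m -expR0 ler_expR oppr_le0 mulr_ge0// ltW.
have exp1 s : 0 <= s -> expR (- (beta * s)) <= 1.
  by move=> s0; rewrite -expR0 ler_expR oppr_le0 mulr_ge0.
elim: k => [|k [e e0 ih]].
  exists 1 => // t t0 tt0 _ s; rewrite mul0r -eq_le => /eqP <-.
  by rewrite mulr0 oppr0 expR0 mulr1 addr0 ler_piMl// ltW.
have [e' /andP[e'0 e'm] he'] :=
  near_max_step _ _ _ _ _ (lt_trans b0 ba) (ltW b0) m0 mM p0 e0 hM.
exists e' => // t t0 tt0 het s /andP[s0 sk].
have mt : m * tail t <= tail (t + a).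
  by apply: le_trans het; rewrite ler_wpM2r ?tail_ge0//; lra.
have [sa|/ltW as_] := leP s a.
  apply: (@le_trans _ _ (tail (t + a))); last first.
    by apply: tail_nonincreasing; rewrite lerD2l.
  by apply: le_trans mt; rewrite ler_piMr ?exp1// mulr_ge0// ltW.
have [v [/andP[bv va] tv0 hv]] := he' t t0 tt0 het.
have tv : 0 <= t + v by rewrite addr_ge0// ltW// (lt_trans b0).
have sv : 0 <= s - v <= k%:R * b.
  rewrite subr_ge0 (le_trans va)//=.
  by move: sk; rewrite -natr1 mulrDl mul1r; move: (_ * b) => kb; lra.
have := ih (t + v) tv tv0 hv (s - v) sv.
rewrite -addrA (addrC v) subrK; apply: le_trans.
have -> : expR (- (beta * s)) = expR (- (beta * v)) * expR (- (beta * (s - v))).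
  by rewrite -expRD -opprD -mulrDr addrC subrK.
rewrite !mulrA ler_pM2r ?expR_gt0// -mulrA (mulrC (tail t)) mulrA.
apply: (@le_trans _ _ (m * (m * tail t))).
  rewrite !mulrA ler_pM2r// ler_pM2l//.
  by rewrite ler_expR lerN2 ler_wpM2l// ltW.
rewrite ler_pM2l//; apply: le_trans mt _; apply: tail_nonincreasing.
by rewrite lerD2l.
Qed.

Lemma tail_eq0Vgt0 t : tail t = 0 \/ 0 < tail t.
Proof.
by have := tail_ge0 mu t; rewrite le_eqVlt eq_sym => /orP[/eqP|]; [left|right].
Qed.

(** Otherwise the supremum of the ratios [tail (t + a) / tail t] exceeds [expR (- (beta * b))] for
    some [b < a]. Near-maximal points then carry exponential minorants over arbitrarily long ranges,
    and iteration gives [rho ^+ n * m <= 1] for all [n] with [rho > 1]. *)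
Lemma tail_le_exp (a beta : R) : 0 <= beta ->
  1 < 2 * \int[mu]_(v in Rplus) expR (- (beta * v)) ->
  0 < a -> (forall b, b < a -> 0 < fine (mu `]b, a]%classic)) ->
  tail a <= expR (- (beta * a)).
Proof.
move=> beta0 hL a0 supp; rewrite leNgt; apply/negP => ha.
have [b [b0 ba hb]] : exists b, [/\ 0 < b, b < a & expR (- (beta * b)) < tail a].
  have ta0 : 0 < tail a by apply: le_lt_trans ha; exact: expR_ge0.
  have taE : tail a = expR (ln (tail a)) by rewrite lnK.
  move: ha; rewrite taE ltr_expR -taE.
  have := ln_le0 (tail_le1 mu a); set w := ln _ => w0 ha.
  have beta1 : 0 < beta.
    by rewrite lt_neqAle beta0 andbT; apply/eqP => h; move: ha; rewrite -h; lra.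
  have wb : - w / beta < a by rewrite ltr_pdivrMr// mulrC; lra.
  have wb0 : 0 <= - w / beta by rewrite divr_ge0// oppr_ge0.
  (* The midpoint of [a] and the point where [expR (- (beta * b))] equals [tail a]. *)
  exists ((a + - w / beta) / 2); split; [lra|lra|].
  rewrite taE -/w ltr_expR mulrA mulrDr (mulrC beta (_ / _)) divfK ?gt_eqF//; lra.
set m := expR (- (beta * b)) in hb.
have m0 : 0 < m by exact: expR_gt0.
(* Where [tail t = 0] the quotient is 0 by convention, which leaves the bound by 1 intact. *)
pose S := [set tail (t + a) / tail t | t in Rplus].
have Sub : ubound S 1.
  move=> _ [t _ <-]; have [->|t0] := tail_eq0Vgt0 t.
    by rewrite invr0 mulr0.
  by rewrite ler_pdivrMr// mul1r; apply: tail_nonincreasing; rewrite lerDl ltW.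
have S0 : S (tail (0 + a) / tail 0) by exists 0 => //=; rewrite in_itv/= lexx.
have Ssup : has_sup S by split; [exists (tail (0 + a) / tail 0)|exists 1].
have hM t : 0 <= t -> tail (t + a) <= sup S * tail t.
  move=> t0; have [tt0|tt0] := tail_eq0Vgt0 t.
    by rewrite tt0 mulr0 -tt0; apply: tail_nonincreasing; rewrite lerDl ltW.
  rewrite -ler_pdivrMr//; apply: (ub_le_sup Ssup.2).
  by exists t => //=; rewrite in_itv/= t0.
have mM : m < sup S.
  apply: (lt_le_trans hb); apply: le_trans (ub_le_sup Ssup.2 S0).
  rewrite add0r ler_pdivlMr; first by rewrite ler_piMr ?tail_ge0 ?tail_le1.
  apply: (lt_le_trans (lt_trans m0 hb)).
  by apply: tail_nonincreasing; exact: ltW.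
have [N N0] := laplace_truncation _ beta0 hL.
set rho := 2 * _ => rho1.
have key n : rho ^+ n * m <= 1.
  (* Enough jumps of length at least [b] to cover the range consumed by [n] substitutions. *)
  have [k hk] : exists k : nat, n%:R * N <= k%:R * b.
    exists (Num.truncn (n%:R * N / b)).+1.
    by rewrite -ler_pdivrMr//; apply: ltW; exact: truncnS_gt.
  have [e e0 he] := near_max_chain _ _ _ _ k b0 ba beta0 mM (supp _ ba) hM.
  (* The cap by [sup S] makes the nearly maximal ratio positive, which rules out [tail t = 0]. *)
  pose e' := Num.min e (sup S).
  have e'0 : 0 < e' by rewrite lt_min e0 (lt_trans m0).
  have e'e : e' <= e by rewrite ge_min lexx.
  have e'S : e' <= sup S by rewrite ge_min lexx orbT.
  have [x [t /=]] := sup_adherent e'0 Ssup.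
  rewrite in_itv/= andbT => t0 <- {x} ht.
  have tt0 : 0 < tail t.
    rewrite lt_neqAle tail_ge0 andbT; apply/eqP => h.
    by move: ht; rewrite -h invr0 mulr0; lra.
  have het : (sup S - e) * tail t <= tail (t + a).
    rewrite -ler_pdivlMr//; lra.
  have hs s : 0 <= s <= n%:R * N ->
      m * tail t * expR (- (beta * s)) <= tail (t + s).
    move=> /andP[s0 sn]; apply: he => //.
    by rewrite s0 (le_trans sn).
  have c0 : 0 <= m * tail t by rewrite mulr_ge0// ltW.
  have := exp_minorant_iter beta N n t (m * tail t) beta0 N0 t0 c0 hs.
  by rewrite mulrA -[leRHS]mul1r ler_pM2r.
have rho0 : 0 < rho by exact: lt_trans rho1.
have : `|rho^-1| < 1 by rewrite gtr0_norm ?invr_gt0// invf_lt1.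
move=> /cvg_expr/cvgr_lt/(_ m m0)[n _ /(_ n (leqnn n))/=].
by rewrite exprVn ltNge -[X in m <= X]mul1r ler_pdivlMr ?exprn_gt0// mulrC key.
Qed.

End deny.

(** * Solutions of the equation are exponential *)

Section exponential_law.
Context {R : realType}.
Variable mu : probability R R.
Local Notation tail := (tail mu).
Local Notation Rplus := (`[(0 : R), +oo[%classic).
Local Notation laplace b := (\int[mu]_(v in Rplus) expR (- (b * v))).
Hypothesis atomless : forall x, mu [set x] = 0%E.
Hypothesis nonneg : mu `]-oo, 0[%classic = 0%E.

(** If []b, a]] is null, [tail] is constant from some rational [q] in []b, a[] up to [a], so [a]
    lies in the level set of [tail q]. There are countably many such level sets, each of them
    null. *)
Lemma left_support_ae : exists N : set R, [/\ measurable N, mu N = 0%E &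
  forall a, ~ N a -> 0 < a /\ forall b, b < a -> 0 < fine (mu `]b, a]%classic)].
Proof.
pose G (n : nat) := if unpickle n is Some q
  then [set v | tail v = tail (@ratr R q)] else set0.
have mG n : measurable (G n).
  by rewrite /G; case: unpickle => // q; exact: measurable_tail_eq.
have G0 n : mu (G n) = 0%E.
  by rewrite /G; case: unpickle => // q; exact: tail_level_null.
have m0 : mu `]-oo, 0]%classic = 0%E.
  rewrite (_ : `]-oo, 0]%classic = `]-oo, 0[ `|` [set (0 : R)]).
    by rewrite measureU0//; exact: atomless.
  by rewrite setUitv1.
have mUG : measurable (\bigcup_n G n) by apply: bigcup_measurable => n _.
have UG0 : mu (\bigcup_n G n) = 0%E.
  apply/(negligibleP _ mUG); apply: negligible_bigcup => n.
  by apply/(negligibleP _ (mG n)); exact: G0.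
exists (`]-oo, 0]%classic `|` \bigcup_n G n); split.
- exact: measurableU.
- by rewrite measureU0.
move=> a Na; split.
  by rewrite ltNge; apply/negP => a0; apply: Na; left; rewrite /= in_itv.
move=> b ba; rewrite lt_neqAle fine_ge0// andbT; apply/eqP => ab0; apply: Na.
have [q] := rat_in_itvoo ba; rewrite in_itv/= => /andP[bq qa].
right; exists (pickle q); first exact: I.
rewrite /G pickleK /mkset.
apply/eqP; rewrite eq_le (tail_nonincreasing _ _ _ (ltW qa))/=.
rewrite -subr_le0 tail_diff ?(ltW qa)// ab0; apply: fine_measure_le => //.
by apply: subset_itv; rewrite bnd_simp// ltW.
Qed.

Lemma laplace0 : laplace 0 = 1.
Proof.
rewrite (@eq_Rintegral _ _ _ mu _ (fun=> 1)); last first.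
  by move=> v _; rewrite mul0r oppr0 expR0.
rewrite Rintegral_cst// mul1r; apply/eqP; rewrite eq_le.
rewrite -lee_fin fineK ?fin_num_measure// probability_le1//=.
rewrite -(tail_at0 _ atomless nonneg); apply: fine_measure_le => //.
by apply: subset_itv; rewrite bnd_simp.
Qed.

Hypothesis tailE : forall t, 0 <= t ->
  tail t = 2 * \int[mu]_(v in Rplus) tail (t + v).

Lemma integrable_tail (A : set R) : measurable A ->
  mu.-integrable A (EFin \o tail).
Proof.
move=> mA; apply: (@bounded_integrable _ _ _ _ _ _ 1) => //.
  exact: measurable_tail.
by move=> x _; rewrite ger0_norm ?tail_ge0// tail_le1.
Qed.

(** With [l] the supremum of the admissible exponents, [expR (- (l * v)) - tail v] is nonnegative
    almost everywhere and has integral at most 0, so it vanishes almost everywhere. *)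
Lemma exponential_tail_ae : exists2 lambda, 0 < lambda & exists N : set R,
  [/\ measurable N, mu N = 0%E &
    forall v, ~ N v -> 0 < v /\ tail v = expR (- (lambda * v))].
Proof.
have [N [mN N0 supp]] := left_support_ae.
pose B := [set b | 0 <= b /\ 1 < 2 * laplace b].
have BN b a : B b -> ~ N a -> tail a <= expR (- (b * a)).
  by move=> [b0 hb] /supp[a0 sa]; exact: tail_le_exp.
have B0 : B 0 by split => //; rewrite laplace0; lra.
have bound a : ~ N a -> 0 < tail a -> ubound B (- ln (tail a) / a).
  move=> Na ta0 b Bb; have [a0 _] := supp _ Na.
  have := BN _ _ Bb Na; rewrite -[X in X <= _]lnK ?posrE// ler_expR.
  by rewrite ler_pdivlMr// lerNr.
(* Such a point makes [B] bounded. If [tail] vanished off [N], the set where [tail v < 2^-1] would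
   have mass 1, against uniformity. *)
have [a Na ta0] : exists2 a, ~ N a & 0 < tail a.
  apply: contrapT => hn.
  suff : fine (mu `]0, +oo[%classic) <= 2^-1.
    by rewrite -/(tail 0) (tail_at0 _ atomless nonneg); lra.
  apply: (@le_trans _ _ (fine (mu [set v | tail v < 2^-1]))); last first.
    by apply: tail_lt_measure.
  apply: (@fine_measure_le_null _ _ _ _ _ _ N) => //; first exact: measurable_tail_lt.
  move=> v _; have [Nv|Nv] := pselect (N v); [by right|left => /=].
  have [->//|tv] := tail_eq0Vgt0 mu v.
  by exfalso; apply: hn; exists v.
have Bsup : has_sup B.
  by split; [exists 0|exists (- ln (tail a) / a); exact: bound].
pose l := sup B.
have l0 : 0 <= l by exact: ub_le_sup Bsup.2 _ B0.
have tl v : ~ N v -> tail v <= expR (- (l * v)).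
  move=> Nv; have [->|tv] := tail_eq0Vgt0 mu v; first exact: expR_ge0.
  have [v0 _] := supp _ Nv.
  have : l <= - ln (tail v) / v by apply: ge_sup; [exists 0|exact: bound].
  by rewrite ler_pdivlMr// lerNr => h; rewrite -[leLHS]lnK ?posrE// ler_expR.
(* If this failed, the exponent could be raised. On [[0, M]], passing from [l] to [l + e] costs at
   most a factor [expR (- (e * M))], and the choice of [e] makes this the inverse square root of
   [rho], so a value above 1 remains. *)
have Ll : 2 * laplace l <= 1.
  rewrite leNgt; apply/negP => /(laplace_truncation mu l l0)[M M0].
  set rho := 2 * _ => rho1.
  have rho0 : 0 < rho by exact: lt_trans rho1.
  pose e := ln rho / (2 * M).
  have e0 : 0 < e by rewrite divr_gt0// ?ln_gt0// mulr_gt0.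
  suff : B (l + e).
    by move/(ub_le_sup Bsup.2); rewrite -/l; lra.
  have le0 : 0 <= l + e by lra.
  split=> //.
  have MR : `[0, M]%classic `<=` Rplus by apply: subset_itvl.
  apply: (@lt_le_trans _ _ (2 * \int[mu]_(v in `[0, M]%classic)
      (expR (- (e * M)) * expR (- (l * v))))); last first.
    rewrite ler_pM2l//.
    apply: (@le_trans _ _ (\int[mu]_(v in `[0, M]%classic)
        expR (- ((l + e) * v)))); last first.
      apply: Rintegral_subset => //.
      exact: integrable_expRN.
    apply: le_Rintegral => //.
    - by apply: integrable_scale => //; exact: integrable_expRN.
    - exact: integrable_expRN.
    - move=> v /=; rewrite in_itv/= => /andP[v0 vM].
      rewrite -expRD ler_expR -opprD lerN2 mulrDl addrC lerD2r.
      by rewrite ler_pM2l.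
  rewrite RintegralZl//; last exact: integrable_expRN.
  rewrite mulrCA -/rho -[X in X < _]expR0 -(lnK rho0) -expRD ltr_expR.
  have -> : e * M = ln rho / 2.
    by rewrite /e invfM mulrA mulfVK// gt_eqF.
  have := ln_gt0 rho1; lra.
pose f v := expR (- (l * v)) - tail v.
have mf : measurable_fun Rplus (EFin \o f).
  apply/measurable_EFinP; apply: measurable_funTS.
  by apply: measurable_funB; [exact: measurable_expRN|exact: measurable_tail].
have fi : mu.-integrable Rplus (EFin \o f).
  have h1 : mu.-integrable Rplus (EFin \o (fun v => expR (- (l * v)))).
    exact: integrable_expRN.
  exact: (integrableB (measurable_itv _) h1 (integrable_tail _ (measurable_itv _))).
(* The equation at 0 gives [tail] the integral 1/2, and the exponential has at most that. *)
have f0 : \int[mu]_(v in Rplus) f v <= 0.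
  rewrite RintegralB//; [|exact: integrable_expRN|exact: integrable_tail].
  have := tailE 0 (lexx _); rewrite (tail_at0 _ atomless nonneg).
  rewrite (@eq_Rintegral _ _ _ mu _ (fun v => tail v)); last first.
    by move=> v _; rewrite add0r.
  lra.
have fabs : (\int[mu]_(v in Rplus) `|(EFin \o f) v|)%E = 0%E.
  apply/eqP; rewrite eq_le integral_ge0 ?andbT; last by move=> v _; exact: abse_ge0.
  rewrite (ae_eq_integral (EFin \o f)) //.
  - by rewrite -[leLHS]fineK ?lee_fin//; exact: integrable_fin_num.
  - exact: measurableT_comp.
  - exists N; split => // v /= hv; apply: contrapT => Nv; apply: hv => _.
    by congr EFin; rewrite ger0_norm// subr_ge0 tl.
have /(ae_eq_integral_abs mu (measurable_itv _) mf) := fabs.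
case=> N' [mN' N'0 hN'].
exists l.
  rewrite lt_neqAle l0 andbT; apply/eqP => l00; move: Ll.
  by rewrite -l00 laplace0; lra.
exists (N `|` N'); split; [exact: measurableU|by rewrite measureU0|].
move=> v; rewrite not_orE => -[Nv N'v]; have [v0 _] := supp _ Nv; split=> //.
apply: contrapT => hv; apply: N'v; apply: hN' => /= h.
apply: hv; have := h _; rewrite in_itv/= andbT => /(_ (ltW v0)) [].
by rewrite /f => /eqP; rewrite subr_eq0 => /eqP.
Qed.

(** Uniformity removes the exceptional set. With [x] the claimed value, up to null sets []t, +oo[]
    is contained in the set where [tail v < x] and contains the one where [tail v <= x], so its mass
    is squeezed to [x]. *)
Lemma exponential_tail : exists2 lambda, 0 < lambda &
  forall t, 0 <= t -> tail t = expR (- (lambda * t)).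
Proof.
have [l l0 [N [mN N0 hN]]] := exponential_tail_ae.
exists l => // t t0; set x := expR _.
have x0 : 0 <= x by exact: expR_ge0.
have x1 : x <= 1 by rewrite /x -expR0 ler_expR oppr_le0 mulr_ge0// ltW.
apply/eqP; rewrite eq_le; apply/andP; split.
  apply: le_trans (tail_lt_measure mu atomless nonneg x x0).
  apply: (@fine_measure_le_null _ _ _ _ _ _ N) => //; first exact: measurable_tail_lt.
  move=> v /=; rewrite in_itv/= andbT => tv.
  have [Nv|/hN[v0 ->]] := pselect (N v); [by right|left].
  by rewrite /x ltr_expR ltrN2 ltr_pM2l.
apply: le_trans (tail_le_measure mu atomless nonneg x x1) _.
have mt := atomless t.
apply: (@fine_measure_le_null _ _ _ _ _ _ (N `|` [set t])) => //.
- exact: measurable_tail_le.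
- exact: measurableU.
- by rewrite measureU0.
move=> v /=; have [Nv|/hN[v0 ->]] := pselect (N v); first by right; left.
rewrite /x ler_expR lerN2 ler_pM2l// le_eqVlt => /predU1P[->|tv].
  by right; right.
by left; rewrite /= in_itv/= tv.
Qed.

End exponential_law.

(** * Joint law of an independent, identically distributed pair *)

Section independent_pair.
Context {d : measure_display} {T : measurableType d} {R : realType}.
Variable P : probability T R.
Variables U V : {mfun T >-> R}.
Hypothesis indepVU : indep2 P V U.
Hypothesis sameVU : same_law P V U.
Local Notation mu := (distribution P U).

(** Independence fixes the joint law on rectangles, so it is the product measure by uniqueness. *)
Lemma indep_joint (A : set (R * R)) : measurable A ->
  P [set w | A (V w, U w)] = (\int[mu]_v mu (xsection A v))%E.
Proof.
move=> mA.
have mW : measurable_fun setT (fun w => (V w, U w)).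
  by apply: measurable_fun_pair.
pose W : {mfun T >-> (R * R)%type} := mfun_Sub (mem_set mW).
have WE (B C : set R) : measurable B -> measurable C ->
    distribution P W (B `*` C) = (mu B * mu C)%E.
  move=> mB mC; transitivity (P (V @^-1` B) * P (U @^-1` C))%E.
    exact: indepVU.
  by rewrite sameVU.
have e := @product_measure_unique _ _ _ _ R mu mu (distribution P W) WE A mA.
exact: (esym e).
Qed.

Lemma measurable_diff_preimage (B : set R) : measurable B ->
  measurable [set p : R * R | B (p.2 - p.1)].
Proof.
move=> mB; rewrite -[X in measurable X]setTI.
have mf : measurable_fun setT (fun p : R * R => p.2 - p.1).
  by apply: measurable_funB; [exact: measurable_snd|exact: measurable_fst].
exact: (mf measurableT _ mB).
Qed.

Lemma indep_diff_gt (t : R) :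
  fine (P [set w | t < U w - V w]) = \int[mu]_v tail mu (t + v).
Proof.
have mA : measurable [set p : R * R | t < p.2 - p.1].
  have := measurable_diff_preimage _ (measurable_itv `]t, +oo[).
  by under eq_set do rewrite /= in_itv/= andbT.
rewrite (indep_joint _ mA); congr fine; apply: eq_integral => v _.
rewrite -[LHS]fineK ?fin_num_measure//; last exact: measurable_xsection.
congr (fine (mu _))%:E; apply/seteqP; split => u /=;
  by rewrite xsectionE/= in_itv/= andbT ltrBrDr.
Qed.

Lemma indep_neq : (forall x, mu [set x] = 0%E) -> P [set w | U w - V w = 0] = 0%E.
Proof.
move=> atomless; have mA := measurable_diff_preimage _ (measurable_set1 0).
rewrite (indep_joint _ mA); apply: integral0_eq => v _.
rewrite (_ : xsection _ _ = [set v]); first exact: atomless.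
apply/seteqP; split => u; rewrite xsectionE/=; first by move/subr0_eq.
by move=> ->; rewrite subrr.
Qed.

End independent_pair.

(** * Survival function of the absolute difference *)

Section absolute_difference.
Context {d : measure_display} {T : measurableType d} {R : realType}.
Variable P : probability T R.
Variables U V : {mfun T >-> R}.
Hypothesis indepUV : indep2 P U V.
Hypothesis sameUV : same_law P U V.
Local Notation mu := (distribution P U).
Hypothesis nonneg : mu `]-oo, 0[%classic = 0%E.

(** The event splits by the sign of [U - V] into two disjoint events of equal probability, which is
    the source of the factor 2. *)
Lemma abs_diff_gt (t : R) : 0 <= t ->
  fine (P [set w | t < `|U w - V w|]) =
  2 * \int[mu]_(v in `[0, +oo[%classic) tail mu (t + v).
Proof.
move=> t0.
have indepVU : indep2 P V U.
  by move=> A B mA mB; rewrite setIC indepUV// muleC.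
have sameVU : same_law P V U by move=> A mA; rewrite sameUV.
have tailUV : tail (distribution P V) = tail mu.
  by apply/funext => s; congr fine; exact: sameVU.
have mdiff (f g : {mfun T >-> R}) : measurable [set w | t < f w - g w].
  rewrite -[X in measurable X]setTI.
  have mfg : measurable_fun setT (fun w => f w - g w) by exact: measurable_funB.
  have := mfg measurableT _ (measurable_itv `]t, +oo[).
  congr (measurable (_ `&` _)).
  by apply/seteqP; split => w /=; rewrite in_itv/= andbT.
have -> : [set w | t < `|U w - V w|] =
    [set w | t < U w - V w] `|` [set w | t < V w - U w].
  apply/seteqP; split => w /=.
    by rewrite lter_normr opprB => /orP.
  by move=> /orP; rewrite lter_normr opprB.
rewrite fine_measureU//; last first.
  by rewrite -subset0 => w /= []; lra.
rewrite (indep_diff_gt _ _ _ indepVU sameVU).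
rewrite (indep_diff_gt _ _ _ indepUV sameUV) tailUV.
have -> : \int[distribution P V]_v tail mu (t + v) =
    \int[mu]_v tail mu (t + v).
  by congr fine; apply: eq_measure_integral => A mA _; exact: sameVU.
suff -> : \int[mu]_v tail mu (t + v) =
    \int[mu]_(v in `[0, +oo[%classic) tail mu (t + v) by rewrite mulr_natl mulr2n.
rewrite /Rintegral; congr fine.
rewrite (@negligible_integral _ _ _ mu setT (`]-oo, (0 : R)[%classic : set R))//.
- by rewrite setTD setCitvl.
- exact: integrable_tail_shift.
Qed.

End absolute_difference.

(** * Laws determined by their tails, and measurability of inversion *)

Lemma eq_law_tail {R : realType} (mu nu : probability R R) :
  (forall x, mu `]x, +oo[%classic = nu `]x, +oo[%classic) ->
  forall A, measurable A -> mu A = nu A.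
Proof.
move=> munu.
apply: (measure_unique (@RGenOInfty.G R) (fun n => `]- n%:R, +oo[%classic)).
- exact: RGenOInfty.measurableE.
- move=> _ _ [x ->] [y ->]; exists (Num.max x y).
  apply/seteqP; split => z /=; rewrite !in_itv/= !andbT gt_max.
    by move=> [xz yz]; apply/andP.
  by move=> /andP.
- by move=> n; exists (- n%:R).
- rewrite -subTset => x _; exists (Num.truncn (- x)).+1 => //=.
  by rewrite in_itv/= andbT ltrNl truncnS_gt.
- by move=> _ [x ->]; exact: munu.
- by move=> n; rewrite -ge0_fin_numE// fin_num_measure.
Qed.

Lemma measurable_inv {R : realType} : measurable_fun setT (@GRing.inv R).
Proof.
have m0 : measurable [set (0 : R)] by exact: measurable_set1.
rewrite -(setUv [set (0 : R)]); apply/measurable_funU => //; first exact: measurableC.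
split; first exact: measurable_fun_set1.
apply: open_continuous_measurable_fun; first exact/closed_openC/closed_eq.
by move=> x; rewrite inE/= => /eqP x0; exact: inv_continuous.
Qed.

(** * Logarithms, and both implications for the ratio *)

Section ratio.
Context {d : measure_display} {T : measurableType d} {R : realType}.
Variable P : probability T R.
Variables X Y : T -> R.
Hypothesis mX : measurable_fun setT X.
Hypothesis mY : measurable_fun setT Y.
Hypothesis indepXY : indep2 P X Y.
Hypothesis sameXY : same_law P X Y.
Hypothesis X_nonneg : nonneg_rv P X.
Hypothesis X_ac : abs_continuous P X.
Let Z w := Num.max (X w / Y w) (Y w / X w).

Let measurable_lnX : measurable_fun setT (fun w => ln (X w)).
Proof. exact: (measurableT_comp (@measurable_ln R) mX). Qed.

Let measurable_lnY : measurable_fun setT (fun w => ln (Y w)).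
Proof. exact: (measurableT_comp (@measurable_ln R) mY). Qed.

Let U : {mfun T >-> R} := mfun_Sub (mem_set measurable_lnX).
Let V : {mfun T >-> R} := mfun_Sub (mem_set measurable_lnY).
Local Notation mu := (distribution P U).

Let measurable_Z : measurable_fun setT Z.
Proof.
by apply: measurable_maxr; apply: measurable_funM => //;
  exact: (measurableT_comp measurable_inv).
Qed.

(** Off this null set the ratios are positive and [ln] is inverse to [expR]. On it [ln] may take its
    default value, so events are compared off [E] throughout. *)
Let E := [set w | X w <= 0] `|` [set w | Y w <= 0].

Let measurable_preimage (f : T -> R) (B : set R) : measurable_fun setT f ->
  measurable B -> measurable (f @^-1` B).
Proof.
by move=> mf mB; rewrite -[X in measurable X]setTI; exact: (mf measurableT).
Qed.

Let leE (f : T -> R) (x : R) : [set w | f w <= x] = f @^-1` `]-oo, x].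
Proof. by apply/seteqP; split => w /=; rewrite in_itv. Qed.

Let gtE (f : T -> R) (x : R) : [set w | x < f w] = f @^-1` `]x, +oo[.
Proof. by apply/seteqP; split => w /=; rewrite in_itv/= andbT. Qed.

Let measurable_E : measurable E.
Proof. by apply: measurableU; rewrite leE; exact: measurable_preimage. Qed.

Let X_atomless x : P (X @^-1` [set x]) = 0%E.
Proof. by apply: X_ac => //; exact: lebesgue_measure_set1. Qed.

Let null_E : P E = 0%E.
Proof.
have X0 : P (X @^-1` `]-oo, 0]) = 0%E.
  rewrite (_ : `]-oo, 0]%classic = `]-oo, 0[ `|` [set (0 : R)]); last first.
    by rewrite setUitv1.
  rewrite preimage_setU measureU0//.
  - exact: measurable_preimage.
  - exact: measurable_preimage.
  - exact: X_atomless.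
rewrite /E !leE measureU0//; [exact: measurable_preimage..|].
by rewrite -X0; apply/esym/sameXY; exact: measurable_itv.
Qed.

Let notE w : ~ E w -> 0 < X w /\ 0 < Y w.
Proof. by move/not_orP => /= [/negP + /negP]; rewrite -!ltNge. Qed.

Let Z_ge1 w : ~ E w -> 1 <= Z w.
Proof.
move=> /notE[x0 y0]; rewrite /Z le_max.
have [yx|/ltW xy] := leP (Y w) (X w); first by rewrite ler_pdivlMr// mul1r yx.
by rewrite [X in _ || X]ler_pdivlMr// mul1r xy orbT.
Qed.

(** Off [E], the absolute value of [ln X - ln Y] is the larger of the logarithms of the two ratios,
    that is [ln Z]. *)
Let Z_gt w t : 0 <= t -> ~ E w -> (t < `|U w - V w|) = (expR t < Z w).
Proof.
move=> t0 /notE[x0 y0]; rewrite lter_normr opprB /Z lt_max /U /V/=.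
rewrite -!ln_div ?posrE//.
by rewrite -[in RHS](lnK (x := X w / Y w)) ?posrE ?divr_gt0//
  -[in RHS](lnK (x := Y w / X w)) ?posrE ?divr_gt0// !ltr_expR.
Qed.

Let X_gt w t : ~ E w -> (t < U w) = (expR t < X w).
Proof. by move=> /notE[x0 _]; rewrite -[in RHS](lnK (x := X w))// ltr_expR. Qed.

Let U_indep : indep2 P U V.
Proof.
move=> A B mA mB.
have mlnA : measurable (@ln R @^-1` A).
  by rewrite -[X in measurable X]setTI; exact: measurable_ln.
have mlnB : measurable (@ln R @^-1` B).
  by rewrite -[X in measurable X]setTI; exact: measurable_ln.
exact: (indepXY _ _ mlnA mlnB).
Qed.

Let U_same : same_law P U V.
Proof.
move=> A mA.
have mlnA : measurable (@ln R @^-1` A).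
  by rewrite -[X in measurable X]setTI; exact: measurable_ln.
exact: (sameXY _ mlnA).
Qed.

Let U_atomless x : mu [set x] = 0%E.
Proof.
rewrite -(X_atomless (expR x)); apply: (@measure_eq_off_null _ _ _ P _ _ E) => //.
  exact: measurable_preimage.
move=> w /notE[x0 _] /=; split => [<-|->]; first by rewrite lnK.
by rewrite expRK.
Qed.

Let tail_U t : tail mu t = fine (P (X @^-1` `]expR t, +oo[)).
Proof.
congr fine; apply: (@measure_eq_off_null _ _ _ P _ _ E) => //.
- exact: measurable_preimage.
- exact: measurable_preimage.
by move=> w nE /=; rewrite !in_itv/= !andbT X_gt.
Qed.

Let measurable_abs t : measurable [set w | t < `|U w - V w|].
Proof.
rewrite gtE; apply: measurable_preimage => //.
by apply: measurableT_comp => //; exact: measurable_funB.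
Qed.

Let tail_Z t : 0 <= t -> mu `]-oo, 0[%classic = 0%E ->
  fine (P (Z @^-1` `]expR t, +oo[)) =
  2 * \int[mu]_(v in `[0, +oo[%classic) tail mu (t + v).
Proof.
move=> t0 U0; rewrite -(abs_diff_gt _ _ _ U_indep U_same U0)//.
congr fine; apply: (@measure_eq_off_null _ _ _ P _ _ E) => //.
- exact: measurable_preimage.
by move=> w nE /=; rewrite !in_itv/= !andbT Z_gt.
Qed.

Let U_nonneg : P (X @^-1` `]-oo, 1[) = 0%E -> mu `]-oo, 0[%classic = 0%E.
Proof.
move=> X1; rewrite -X1; apply: (@measure_eq_off_null _ _ _ P _ _ E) => //.
- exact: measurable_preimage.
- exact: measurable_preimage.
move=> w /notE[x0 _] /=; rewrite !in_itv/=.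
by rewrite -[in X in _ <-> is_true X](lnK (x := X w))// -expR0 ltr_expR.
Qed.

Let powR_expR (a t : R) : (expR t) `^ (- a) = expR (- (a * t)).
Proof. by rewrite /powR gt_eqF ?expR_gt0// expRK mulNr. Qed.

(** Since [Z >= 1] off [E], equality of laws forces [U >= 0] almost surely. It then equates the tail
    of [U] with that of the absolute difference, which is the integral equation. *)
Lemma same_law_ratio_pareto : same_law P X Z -> pareto_law P X.
Proof.
move=> sXZ.
have X1 : P (X @^-1` `]-oo, 1[) = 0%E.
  rewrite (sXZ _ (measurable_itv _)); apply: (@measure_sub_null _ _ _ P _ E) => //.
    exact: measurable_preimage.
  move=> w /=; rewrite in_itv/= => Zw; apply: contrapT => /Z_ge1.
  by rewrite leNgt Zw.
have U0 := U_nonneg X1.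
have [l l0 hl] : exists2 l, 0 < l &
    forall t, 0 <= t -> tail mu t = expR (- (l * t)).
  apply: exponential_tail => // t t0.
  by rewrite tail_U (sXZ _ (measurable_itv _)) tail_Z.
exists l; split => // x; rewrite /pareto_cdf.
have [x1|x1] := ltP x 1.
  apply: (@measure_sub_null _ _ _ P _ (X @^-1` `]-oo, 1[)) => //.
  - exact: measurable_preimage.
  - exact: measurable_preimage.
  - by move=> w /=; rewrite !in_itv/= => /le_lt_trans; apply.
have x0 : 0 < x by exact: lt_le_trans x1.
have mXx := measurable_preimage _ _ mX (measurable_itv `]-oo, x]).
rewrite -[LHS]fineK ?fin_num_measure//; congr EFin.
have mXx' := measurable_preimage _ _ mX (measurable_itv `]x, +oo[).
rewrite -setCitvr preimage_setC fine_measureC//.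
congr (1 - _); rewrite -{1}(lnK x0) -tail_U hl ?ln_ge0//.
by rewrite -powR_expR lnK.
Qed.

(** For exponential [U] the integral factors, so the tail of [Z] at [expR t] is [expR (- (a * t))]
    times a constant [2 * L], and it remains to see that this constant is 1. *)
Lemma pareto_same_law_ratio : pareto_law P X -> same_law P X Z.
Proof.
move=> [a [a0 ha]].
have Xgt t : 0 <= t -> fine (P (X @^-1` `]expR t, +oo[)) = expR (- (a * t)).
  have mXt := measurable_preimage _ _ mX (measurable_itv `]-oo, expR t]).
  move=> t0; rewrite -setCitvl preimage_setC fine_measureC//.
  rewrite ha /pareto_cdf ltNge -[X in X <= _]expR0 ler_expR t0/= powR_expR.
  by rewrite opprB addrC subrK.
have X1 : P (X @^-1` `]-oo, 1[) = 0%E.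
  apply: (@measure_sub_null _ _ _ P _ (X @^-1` `]-oo, 1])) => //.
  - exact: measurable_preimage.
  - exact: measurable_preimage.
  - by rewrite ha /pareto_cdf ltxx powR1 subrr.
  - by move=> w /=; rewrite !in_itv/= => /ltW.
have U0 := U_nonneg X1.
have tl t : 0 <= t -> tail mu t = expR (- (a * t)) by move=> t0; rewrite tail_U Xgt.
pose L := \int[mu]_(v in `[0, +oo[%classic) expR (- (a * v)).
have Zgt t : 0 <= t ->
    fine (P (Z @^-1` `]expR t, +oo[)) = expR (- (a * t)) * (2 * L).
  move=> t0; rewrite tail_Z// mulrCA; congr (_ * _); rewrite /L -RintegralZl//; last first.
    by apply: integrable_expRN => //; exact: ltW.
  apply: eq_Rintegral => v; rewrite inE/= in_itv/= andbT => v0.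
  by rewrite tl ?addr_ge0// mulrDr opprD expRD.
have measurable_eqUV : measurable [set w | U w - V w = 0].
  have mUV : measurable_fun setT (fun w => U w - V w) by exact: measurable_funB.
  exact: (measurable_preimage _ _ mUV (measurable_set1 0)).
(* The integral [L] is not computed. At [t = 0] the constant is the probability of [Z > 1], which is
   1 because [U] and [V] differ almost surely. *)
have L1 : 2 * L = 1.
  have := Zgt 0 (lexx 0); rewrite mulr0 oppr0 expR0 mul1r => <-.
  have -> : P (Z @^-1` `]1, +oo[) = P setT.
    apply: (@measure_eq_off_null _ _ _ P _ _ (E `|` [set w | U w - V w = 0])) => //.
    - exact: measurable_preimage.
    - by apply: measurableU => //; exact: measurable_eqUV.
    - rewrite measureU0//.
      apply: indep_neq => //; last by move=> A mA; rewrite U_same.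
      by move=> A B mA mB; rewrite setIC U_indep// muleC.
    move=> w /not_orP[nE /= UV]; split => // _.
    rewrite in_itv/= andbT -expR0 -Z_gt// normr_gt0.
    exact/eqP.
  by rewrite probability_setT.
have key x : P (X @^-1` `]x, +oo[) = P (Z @^-1` `]x, +oo[).
  have mXx := measurable_preimage _ _ mX (measurable_itv `]x, +oo[).
  have mZx := measurable_preimage _ _ measurable_Z (measurable_itv `]x, +oo[).
  have [x1|x1] := leP 1 x.
    have x0 : 0 < x by exact: lt_le_trans x1.
    rewrite -[LHS]fineK ?fin_num_measure// -[RHS]fineK ?fin_num_measure//.
    by congr EFin; rewrite -(lnK x0) Xgt ?Zgt ?ln_ge0// L1 mulr1.
  (* For [x < 1] both events are almost sure, as [X] and [Z] are at least 1 off a null set. *)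
  apply: (@measure_eq_off_null _ _ _ P _ _ (E `|` X @^-1` `]-oo, 1[)) => //.
  - by apply: measurableU => //; exact: measurable_preimage.
  - by rewrite measureU0//; exact: measurable_preimage.
  move=> w /not_orP[nE /= X1w]; rewrite !in_itv/= !andbT.
  have -> : x < Z w by exact: lt_le_trans (Z_ge1 _ nE).
  split => // _; apply: (lt_le_trans x1); rewrite leNgt; apply/negP => X1'.
  by apply: X1w; rewrite in_itv.
pose X' : {mfun T >-> R} := mfun_Sub (mem_set mX).
pose Z' : {mfun T >-> R} := mfun_Sub (mem_set measurable_Z).
exact: (eq_law_tail (distribution P X') (distribution P Z') key).
Qed.

End ratio.

Theorem theorem1 (d : measure_display) (T : measurableType d) (R : realType)
  (P : probability T R) (X Y : T -> R)
  (mX : measurable_fun setT X) (mY : measurable_fun setT Y)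
  (hind : indep2 P X Y) (hid : same_law P X Y)
  (hX0 : nonneg_rv P X) (hac : abs_continuous P X) :
  same_law P X (fun w => Num.max (X w / Y w) (Y w / X w)) <-> pareto_law P X.
Proof.
by split; [exact: same_law_ratio_pareto|exact: pareto_same_law_ratio].
Qed.
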